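(* Let $A\in\mathcal{M}_d(\mathbb{C})$ be self-adjoint, let $\mathcal{X},\mathcal{Y}\subset\mathbb{C}^d$ be subspaces with $\dim(\mathcal{X})=\dim(\mathcal{Y})=k$, let $X,Y\in\mathcal{M}_{d,k}(\mathbb{C})$ have columns forming orthonormal bases of $\mathcal{X}$ and $\mathcal{Y}$, respectively, and assume that $\mathcal{X}$ is $A$-invariant. If $\Theta_1(\mathcal{X},\mathcal{Y})<\frac{\pi}{2}$, then $$|\lambda(\rho(X))-\lambda(\rho(Y))|\prec_w \frac{2\,\big(\lambda_i(A_{\mathcal{X}+\mathcal{Y}})-\lambda_{\min}(A_{\mathcal{X}+\mathcal{Y}})\big)_{i=1}^k\,\sin^2(\Theta(\mathcal{X},\mathcal{Y}))}{\cos(\Theta(\mathcal{X},\mathcal{Y}))}.$$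
   Context: $\mathcal{M}_{d,k}(\mathbb{C})$ is the space of complex $d\times k$ matrices and $\mathcal{M}_d(\mathbb{C})=\mathcal{M}_{d,d}(\mathbb{C})$. Set $\rho(X)=X^*AX$, $\rho(Y)=Y^*AY$. For a self-adjoint matrix or operator $C$, $\lambda(C)=(\lambda_i(C))_i$ is the vector of eigenvalues counted with multiplicity in non-increasing order and $\lambda_{\min}(C)$ is the smallest eigenvalue. $A_{\mathcal{X}+\mathcal{Y}}=P_{\mathcal{X}+\mathcal{Y}}A|_{\mathcal{X}+\mathcal{Y}}$ is the compression of $A$ to $\mathcal{X}+\mathcal{Y}$ (a self-adjoint operator on $\mathcal{X}+\mathcal{Y}$; $P_{\mathcal{Z}}$ is the orthogonal projection onto $\mathcal{Z}$). The principal angles $\Theta(\mathcal{X},\mathcal{Y})=(\Theta_i(\mathcal{X},\mathcal{Y}))_{i=1}^k$, with $\pi/2\ge\Theta_1\ge\dots\ge\Theta_k\ge0$, are defined by $\cos(\Theta_{k-i+1}(\mathcal{X},\mathcal{Y}))=s_i(X^*Y)$, where $s_1\ge\dots\ge s_k$ are singular values. Operations on vectors are entrywise. For $x,y\in\mathbb{R}^k$, $x\prec_w y$ (submajorization) means $\sum_{i=1}^j x_i^\downarrow\le\sum_{i=1}^j y_i^\downarrow$ for every $1\le j\le k$, where $x^\downarrow$ is $x$ rearranged in non-increasing order. *)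

(* Defs.v *)
From mathcomp Require Import all_boot all_order all_algebra.
From mathcomp Require Import spectral sesquilinear.
From mathcomp Require Import complex.
From mathcomp Require Import reals trigo.

Set Implicit Arguments.
Unset Strict Implicit.
Unset Printing Implicit Defensive.

Import Order.TTheory GRing.Theory Num.Theory.
Local Open Scope ring_scope.
Local Open Scope complex_scope.
Local Open Scope sesquilinear_scope.

(* The roots of the characteristic polynomial, repeated according to
   multiplicity.  Taking real parts loses nothing for the matrices of
   self-adjoint operators, whose eigenvalues are real. *)
Definition eigenvalues (R : realType) (n : nat) (M : 'M[R[i]]_n) : seq R :=
  sort >=%R [seq complex.Re z
            | z <- sval (closed_field_poly_normal (char_poly M))].

(* The matrix is taken in an arbitrary, not necessarily orthonormal, basis;
   the characteristic polynomial does not depend on this choice. *)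
Definition op_eigenvalues (R : realType) (V : vectType R[i])
    (f : 'End(V)) : seq R :=
  eigenvalues (passmx.mxof (vbasis {:V}) (vbasis {:V}) f).

Definition singular_values (R : realType) (m n : nat)
    (M : 'M[R[i]]_(m, n)) : seq R :=
  [seq Num.sqrt x | x <- eigenvalues (M^t* *m M)].

Definition orthocompl (R : realType) (d : nat)
    (Z : {vspace 'cV[R[i]]_d}) : {vspace 'cV[R[i]]_d} :=
  (\bigcap_(u <- vbasis Z) lker (linfun (mulmx (u^t* ) : 'cV_d -> 'cV_1)))%VS.

Definition orthoproj (R : realType) (d : nat)
    (Z : {vspace 'cV[R[i]]_d}) : 'End('cV[R[i]]_d) :=
  daddv_pi Z (orthocompl Z).

(* [vsproj Z] only retypes [orthoproj Z _], which already lies in [Z], as an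
   element of the subspace [Z]. *)
Definition compression (R : realType) (d : nat) (A : 'M[R[i]]_d)
    (Z : {vspace 'cV[R[i]]_d}) : 'End(subvs_of Z) :=
  (linfun (vsproj Z) \o (orthoproj Z \o (linfun (mulmx A) \o linfun vsval)))%VF.

Definition orthonormal_basis (R : realType) (d k : nat)
    (Z : {vspace 'cV[R[i]]_d}) (B : 'M[R[i]]_(d, k)) : Prop :=
  basis_of Z [seq col j B | j <- enum 'I_k] /\ B^t* *m B = 1%:M.

(* For matrices X and Y with orthonormal columns: since the i-th singular value
   is the cosine of the (k-i+1)-th angle, the list is reversed, and the angles
   come out in non-increasing order. *)
Definition principal_angles (R : realType) (d k : nat)
    (X Y : 'M[R[i]]_(d, k)) : seq R :=
  rev [seq acos s | s <- singular_values (X^t* *m Y)].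

Definition submajorized (R : realType) (k : nat) (x y : 'rV[R]_k) : Prop :=
  forall j : nat, (1 <= j <= k)%N ->
    \sum_(i < j) (sort >=%R [seq x 0 l | l <- enum 'I_k])`_i <=
    \sum_(i < j) (sort >=%R [seq y 0 l | l <- enum 'I_k])`_i.

(* Main.v *)
(* Passing to the compression of [A] to the sum of the two subspaces and
   subtracting its least eigenvalue, assume [A >= 0].  Put [C = X^* Y],
   [A1 = X^* A X] and [T = Y - X C], so that [T^* T = 1 - C^* C] has the
   eigenvalues [sin^2 Theta_i].  Since [X] spans an [A]-invariant subspace,
   [Y^* A Y = C^* A1 C + T^* A T].  With [H = A1^(1/2)] the matrix [C^* A1 C] is
   isospectral to [H C C^* H], and [A1 - H C C^* H = H (1 - C C^* ) H].  Hence
   the spectra of [X^* A X] and [Y^* A Y] both arise from the one of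
   [C^* A1 C] by adding a positive semidefinite matrix.  By Lidskii's
   inequality each of the two changes is weakly majorized by the spectrum of
   the added matrix, which in turn is weakly majorized by
   [lambda_i (A) sin^2 Theta_i].  This gives the bound without the factor
   [1 / cos Theta_i >= 1]; the hypothesis on [Theta_1] makes the cosines
   positive. *)

Require Import Defs.
From mathcomp Require Import all_boot all_order all_algebra.
From mathcomp Require Import perm spectral sesquilinear.
From mathcomp Require Import complex.
From mathcomp Require Import reals trigo.
From mathcomp Require Import ring lra.

Set Implicit Arguments.
Unset Strict Implicit.
Unset Printing Implicit Defensive.

Import Order.TTheory GRing.Theory Num.Theory.
Local Open Scope ring_scope.
Local Open Scope complex_scope.
Local Open Scope sesquilinear_scope.

(** * Characteristic polynomials of products in either order *)

Lemma det_scalar_sub_mulmxC (K : comNzRingType) n (x : K) (A B : 'M[K]_n) :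
  x ^+ n * \det (x%:M - A *m B) = x ^+ n * \det (x%:M - B *m A).
Proof.
(* [W *m Z] and [Z *m W] have the same determinant and are both block upper triangular. The power of
   [x] stays because [x] need not be invertible. *)
pose W := block_mx (x%:M : 'M_n) A B (1%:M : 'M_n).
pose Z := block_mx (1%:M : 'M_n) 0 (- B) (x%:M : 'M_n).
have h1 : W *m Z = block_mx (x%:M - A *m B) (x *: A) 0 x%:M.
  rewrite mulmx_block !mulmx1 !mulmx0 !mulmxN !mul1mx subrr !add0r.
  by rewrite mul_mx_scalar.
have h2 : Z *m W = block_mx x%:M A 0 (x%:M - B *m A).
  rewrite mulmx_block !mul1mx !mul0mx !addr0 mulmx1 !mulNmx.
  by rewrite mul_mx_scalar mul_scalar_mx addNr addrC.
have := congr1 determinant h1; have := congr1 determinant h2.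
rewrite !det_mulmx !det_ublock !det_scalar => <- h.
by rewrite mulrC -h mulrC.
Qed.

Lemma char_poly_mulmxC (F : fieldType) n (A B : 'M[F]_n) :
  char_poly (A *m B) = char_poly (B *m A).
Proof.
have X0 : 'X ^+ n != 0 :> {poly F} by rewrite expf_neq0 ?polyX_eq0.
apply: (mulfI X0).
rewrite /char_poly /char_poly_mx !map_mxM.
exact: det_scalar_sub_mulmxC.
Qed.

(** * Eigenvalues of self-adjoint matrices *)

Section Spectrum.
Variable R : realType.
Implicit Types (m n : nat).

Lemma adjmxM m n p (A : 'M[R[i]]_(m, n)) (B : 'M_(n, p)) :
  (A *m B)^t* = B^t* *m A^t*.
Proof. by rewrite trmx_mul map_mxM. Qed.

Lemma adjmx1 n : (1%:M : 'M[R[i]]_n)^t* = 1%:M.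
Proof. by rewrite trmx1 map_mx1. Qed.

Lemma adjmxD m n (A B : 'M[R[i]]_(m, n)) : (A + B)^t* = A^t* + B^t*.
Proof. by rewrite linearD map_mxD. Qed.

Lemma adjmxN m n (A : 'M[R[i]]_(m, n)) : (- A)^t* = - A^t*.
Proof. by rewrite linearN map_mxN. Qed.

Lemma hermE n (A : 'M[R[i]]_n) : (A \is hermsymmx) = (A^t* == A).
Proof. by rewrite is_hermitianmxE expr0 scale1r eq_sym. Qed.

Lemma conjC_real (x : R) : (x%:C)^*%R = x%:C.
Proof. by apply/CrealP; rewrite complex_real. Qed.

Definition diagR n (s : seq R) : 'M[R[i]]_n := diag_mx (\row_(i < n) (s`_i)%:C).

Lemma adj_diagR n s : (diagR n s)^t* = diagR n s.
Proof.
rewrite /diagR tr_diag_mx map_diag_mx; congr diag_mx.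
by apply/rowP=> i; rewrite !mxE; apply: conjC_real.
Qed.

Lemma eigenvalues_char n (A B : 'M[R[i]]_n) :
  char_poly A = char_poly B -> eigenvalues A = eigenvalues B.
Proof. by rewrite /eigenvalues => ->. Qed.

Lemma eigenvalues_mulmxC n (A B : 'M[R[i]]_n) :
  eigenvalues (A *m B) = eigenvalues (B *m A).
Proof. exact/eigenvalues_char/char_poly_mulmxC. Qed.

(** The roots chosen inside [eigenvalues] are determined only up to order; sorting makes the result
    independent of the choice. *)
Lemma eigenvalues_perm n (M : 'M[R[i]]_n) (s : seq R[i]) :
  char_poly M = \prod_(z <- s) ('X - z%:P) ->
  eigenvalues M = sort >=%R [seq complex.Re z | z <- s].
Proof.
rewrite /eigenvalues => hM; case: closed_field_poly_normal => r /= hr.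
move: hr; rewrite (monicP (char_poly_monic M)) scale1r hM => /prod_XsubC_eq hp.
apply/perm_sortP; last by apply: perm_map; rewrite perm_sym.
- exact: ge_total.
- exact: ge_trans.
- exact: ge_anti.
Qed.

Lemma eigenvalues_diagR n (U V : 'M[R[i]]_n) (s : seq R) : V *m U = 1%:M ->
  size s = n -> eigenvalues (U *m diagR n s *m V) = sort >=%R s.
Proof.
move=> VU ss; rewrite -mulmxA eigenvalues_mulmxC -mulmxA VU mulmx1.
rewrite (@eigenvalues_perm _ _ [seq x%:C | x <- s]) -?map_comp ?map_id //.
rewrite char_poly_trig ?is_diag_mx_is_trig ?diag_mx_is_diag //.
rewrite big_map (big_nth 0) ss big_mkord; apply: eq_bigr => i _.
by rewrite !mxE eqxx.
Qed.

Lemma size_eigenvalues n (M : 'M[R[i]]_n) : size (eigenvalues M) = n.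
Proof.
rewrite /eigenvalues size_sort size_map.
case: closed_field_poly_normal => r /= hr.
have := size_char_poly M; rewrite hr (monicP (char_poly_monic M)) scale1r.
by rewrite size_prod_XsubC => -[].
Qed.

Lemma sorted_eigenvalues n (M : 'M[R[i]]_n) : sorted >=%R (eigenvalues M).
Proof. exact: (sort_sorted ge_total). Qed.

Lemma le_eigenvalues n (M : 'M[R[i]]_n) i j : (i <= j < n)%N ->
  (eigenvalues M)`_j <= (eigenvalues M)`_i.
Proof.
move=> /andP[ij jn].
apply: (@sorted_leq_nth _ >=%R _ _ _ _ (sorted_eigenvalues M)) => //.
- exact: ge_trans.
- exact: ge_refl.
- by rewrite inE size_eigenvalues (leq_ltn_trans ij).
- by rewrite inE size_eigenvalues.
Qed.

(** The spectral theorem with ordered eigenvectors: a permutation of the columns makes column [i] of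
    [U] belong to the entry of index [i] of the sorted spectrum. *)
Lemma herm_spectral n (M : 'M[R[i]]_n) : M^t* = M ->
  exists2 U : 'M[R[i]]_n, U^t* *m U = 1%:M &
    M = U *m diagR n (eigenvalues M) *m U^t*.
Proof.
move=> /eqP; rewrite -hermE => hM.
have /orthomx_spectralP := hermitian_normalmx hM.
set W := spectralmx M; set d := spectral_diag M => eM.
have uW : W \is unitarymx by apply: spectral_unitarymx.
rewrite invmx_unitary // in eM.
have WW : W *m W^t* = 1%:M by apply/unitarymxP.
have WW' : W^t* *m W = 1%:M by apply: mulmx1C.
pose s : n.-tuple R := [tuple complex.Re (d 0 i) | i < n].
have ds : diag_mx d = diagR n s.
  congr diag_mx; apply/rowP=> i; rewrite !mxE.
  rewrite -(tnth_nth _ s) tnth_mktuple RRe_real //.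
  by have /mxOverP := hermitian_spectral_diag_real hM; apply.
have eE : eigenvalues M = sort >=%R s.
  by rewrite {1}eM ds eigenvalues_diagR ?size_tuple.
have /tuple_permP[p hp] : perm_eq (eigenvalues M) s by rewrite eE perm_sort.
exists (col_perm p (W^t*)).
  apply/matrixP=> i j; have /matrixP/(_ (p i) (p j)) := WW.
  rewrite !mxE (inj_eq perm_inj) => <-; apply: eq_bigr => l _.
  by rewrite !mxE /= !conjCK.
rewrite {1}eM ds; apply/matrixP=> i j; rewrite !mul_mx_diag !mxE.
rewrite (reindex_inj (@perm_inj _ p)); apply: eq_bigr => l _.
rewrite !mxE hp -tnth_nth -(tnth_nth _ [tuple _ | _ < _]) tnth_mktuple.
by rewrite /= conjCK.
Qed.

End Spectrum.

(** * Variational inequalities *)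

Section QuadraticForm.
Variable R : realType.
Implicit Types (m n : nat).

Definition sqmod (z : R[i]) : R := complex.Re (z^*%R * z).

Lemma sqmod_ge0 z : 0 <= sqmod z.
Proof. by case: z => a b; rewrite /sqmod /=; nra. Qed.

Lemma sqmod0 : sqmod 0 = 0.
Proof. by rewrite /sqmod mulr0. Qed.

Lemma sqmod_eq0 z : sqmod z = 0 -> z = 0.
Proof.
case: z => a b; rewrite /sqmod /= => h.
have -> : a = 0 by nra.
by have -> : b = 0 by nra.
Qed.

(** For self-adjoint [M] the form is already real, so the real part only changes the type. *)
Definition qf n (M : 'M[R[i]]_n) (v : 'cV_n) : R :=
  complex.Re ((v^t* *m M *m v) 0 0).

Lemma ReD (x y : R[i]) : complex.Re (x + y) = complex.Re x + complex.Re y.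
Proof. by case: x; case: y. Qed.

Lemma Re_sum I (r : seq I) (P : pred I) (F : I -> R[i]) :
  complex.Re (\sum_(i <- r | P i) F i) = \sum_(i <- r | P i) complex.Re (F i).
Proof. by apply: (big_morph (@complex.Re R)) => //; exact: ReD. Qed.

Lemma ReM_real (c : R) (x : R[i]) : complex.Re (c%:C * x) = c * complex.Re x.
Proof. by case: x => a b /=; rewrite mul0r subr0. Qed.

Lemma qfD n (A B : 'M_n) v : qf (A + B) v = qf A v + qf B v.
Proof. by rewrite /qf mulmxDr mulmxDl mxE ReD. Qed.

Lemma qf_scalar n (c : R) v : qf (c%:C%:M : 'M_n) v = c * qf 1%:M v.
Proof.
rewrite /qf -[c%:C%:M]scalemx1 -scalemxAr -scalemxAl mxE.
exact: ReM_real.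
Qed.

Lemma qf_conj m n (V : 'M_(n, m)) (M : 'M_n) v :
  qf (V^t* *m M *m V) v = qf M (V *m v).
Proof. by rewrite /qf adjmxM !mulmxA. Qed.

Lemma qf_diagR n s v : qf (diagR n s) v = \sum_(i < n) s`_i * sqmod (v i 0).
Proof.
rewrite /qf mxE Re_sum; apply: eq_bigr => i _.
by rewrite mul_mx_diag !mxE mulrAC mulrC ReM_real.
Qed.

Lemma qf1 n v : qf (1%:M : 'M_n) v = \sum_(i < n) sqmod (v i 0).
Proof.
by rewrite /qf mulmx1 mxE Re_sum; apply: eq_bigr => i _; rewrite !mxE.
Qed.

Lemma qf1_ge0 n v : 0 <= qf (1%:M : 'M_n) v.
Proof. by rewrite qf1; apply: sumr_ge0 => i _; apply: sqmod_ge0. Qed.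

Lemma qf1_gt0 n (v : 'cV_n) : v != 0 -> 0 < qf (1%:M : 'M_n) v.
Proof.
move=> v0; rewrite lt0r qf1_ge0 andbT qf1; apply: contra v0 => /eqP h.
apply/eqP/colP => i; rewrite [RHS]mxE; apply: sqmod_eq0; move: (i) isT.
apply: psumr_eq0P h => j _; apply: sqmod_ge0.
Qed.

Lemma qf_gram m n (K : 'M_(n, m)) v : qf (K^t* *m K) v = qf 1%:M (K *m v).
Proof. by rewrite -[K^t*]mulmx1 qf_conj. Qed.

Lemma qf1_isometry m n (V : 'M_(n, m)) v : V^t* *m V = 1%:M ->
  qf 1%:M (V *m v) = qf 1%:M v.
Proof. by move=> h; rewrite -qf_gram h. Qed.

Lemma qf_spectral n (U : 'M_n) s v :
  qf (U *m diagR n s *m U^t*) v = \sum_(i < n) s`_i * sqmod ((U^t* *m v) i 0).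
Proof. by rewrite -{1}[U]trmxCK qf_conj qf_diagR. Qed.

(** Extracts the coordinates from [o] to [o + r - 1]. Its kernel encodes their vanishing as linear
    constraints; for [o = 0] and [r <= n] its adjoint is an isometric inclusion. *)
Definition selmx r o n : 'M[R[i]]_(r, n) :=
  \matrix_(q, l) (l == q + o :> nat)%N%:R.

Lemma selmx_eq0 r o n (w : 'cV_n) (l : 'I_n) : selmx r o n *m w = 0 ->
  (o <= l < o + r)%N -> w l 0 = 0.
Proof.
move=> /colP h /andP[ol lo].
have q : (l - o < r)%N by rewrite ltn_subLR.
have := h (Ordinal q); rewrite !mxE /= (bigD1 l) //= big1 ?addr0.
  by rewrite mxE subnK // eqxx mul1r.
move=> j jl; rewrite mxE subnK // (_ : (_ == _) = false) ?mul0r //.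
exact: negbTE.
Qed.

Lemma exists_ker_col (F : fieldType) r m (K : 'M[F]_(r, m)) : (r < m)%N ->
  exists2 w : 'cV_m, w != 0 & K *m w = 0.
Proof.
move=> rm; have : kermx K^T != 0.
  rewrite kermx_eq0 /row_free mxrank_tr neq_ltn.
  by rewrite (leq_ltn_trans (rank_leq_row K)).
rewrite -nz_row_eq0 => h; exists (nz_row (kermx K^T))^T.
  by rewrite -trmx0 (inj_eq trmx_inj).
by rewrite -{1}[K]trmxK -trmx_mul (sub_kermxP (nz_row_sub _)) trmx0.
Qed.

(* Courant-Fischer: on a subspace of codimension at most [i] some nonzero
   vector is spanned by the first [i + 1] eigenvectors. *)
Lemma eigenvalues_le_codim m r (B : 'M[R[i]]_m) (N : 'M_(r, m)) i c :
  B^t* = B -> (r <= i < m)%N ->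
  (forall v, N *m v = 0 -> qf B v <= c * qf 1%:M v) ->
  (eigenvalues B)`_i <= c.
Proof.
move=> hB /andP[ri im] hN.
have [U UU eB] := herm_spectral hB.
(* There are [r] constraints from [N] and [m - i.+1] from the vanishing of the coordinates beyond
   [i], fewer than [m] in all since [r <= i]. *)
have [|w w0 /eqP] := @exists_ker_col _ _ _
    (col_mx (N *m U) (selmx (m - i.+1) i.+1 m)).
  by rewrite -ltn_subRL ltn_sub2l // (leq_ltn_trans ri im).
rewrite mul_col_mx col_mx_eq0 => /andP[/eqP NU0 /eqP sel0].
have w_high (l : 'I_m) : (i < l)%N -> w l 0 = 0.
  by move=> il; apply: (selmx_eq0 sel0); rewrite il subnKC ?ltn_ord.
have := hN (U *m w); rewrite mulmxA NU0 => /(_ erefl).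
rewrite qf1_isometry // {1}eB qf_spectral mulmxA UU mul1mx => h.
rewrite -(ler_pM2r (qf1_gt0 w0)); apply: le_trans h.
rewrite qf1 mulr_sumr; apply: ler_sum => l _.
have [li|il] := leqP l i; last by rewrite w_high // sqmod0 !mulr0.
by rewrite ler_wpM2r ?sqmod_ge0 // le_eigenvalues // li.
Qed.

(** Courant-Fischer with the [i] constraints that [V *m v] be orthogonal to the first [i]
    eigenvectors of [P]: there the form of [P] is at most its eigenvalue of index [i] times the
    squared norm. *)
Lemma eigenvalues_interlacing m n (B : 'M[R[i]]_m) (P : 'M_n)
    (V : 'M_(n, m)) i :
  B^t* = B -> P^t* = P -> V^t* *m V = 1%:M ->
  (forall v, qf B v <= qf P (V *m v)) -> (i < m)%N ->
  (eigenvalues B)`_i <= (eigenvalues P)`_i.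
Proof.
move=> hB hP hV hle im.
have mn : (m <= n)%N by apply: mulmx1_min hV.
have [U UU eP] := herm_spectral hP.
have UU' := mulmx1C UU.
apply: (@eigenvalues_le_codim _ i _ (selmx i 0 n *m (U^t* *m V))) => //.
  by rewrite leqnn.
move=> v; rewrite -!mulmxA => sel0.
apply: le_trans (hle v) _.
rewrite {1}eP qf_spectral -(qf1_isometry v hV).
rewrite -(@qf1_isometry _ _ (U^t*)) ?trmxCK // qf1 mulr_sumr.
apply: ler_sum => l _; have [li|il] := ltnP l i.
  by rewrite (selmx_eq0 sel0) ?sqmod0 ?mulr0.
by rewrite ler_wpM2r ?sqmod_ge0 // le_eigenvalues // il ltn_ord.
Qed.

Lemma eigenvalues_mono n (A B : 'M[R[i]]_n) i : A^t* = A -> B^t* = B ->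
  (forall v, qf A v <= qf B v) -> (i < n)%N ->
  (eigenvalues A)`_i <= (eigenvalues B)`_i.
Proof.
move=> hA hB h; apply: (@eigenvalues_interlacing _ _ _ _ 1%:M) => //.
  by rewrite mulmx1 adjmx1.
by move=> v; rewrite mul1mx.
Qed.

Lemma trace_diagR n (U : 'M[R[i]]_n) s : U^t* *m U = 1%:M ->
  complex.Re (\tr (U *m diagR n s *m U^t*)) = \sum_(i < n) s`_i.
Proof.
move=> UU; rewrite mxtrace_mulC mulmxA UU mul1mx mxtrace_diag Re_sum.
by apply: eq_bigr => i _; rewrite mxE.
Qed.

Lemma trace_eigenvalues n (M : 'M[R[i]]_n) : M^t* = M ->
  complex.Re (\tr M) = \sum_(i < n) (eigenvalues M)`_i.
Proof. by move=> /herm_spectral[U UU {1}->]; rewrite trace_diagR. Qed.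

Lemma spectral_diagR_shift n (U : 'M[R[i]]_n) s c : U *m U^t* = 1%:M ->
  size s = n -> U *m diagR n s *m U^t* + c%:C%:M =
  U *m diagR n [seq x + c | x <- s] *m U^t*.
Proof.
move=> UU ss.
have -> : diagR n [seq x + c | x <- s] = diagR n s + c%:C%:M.
  rewrite /diagR -diag_const_mx -linearD /=; congr diag_mx.
  by apply/rowP => i; rewrite !mxE (nth_map 0) ?ss // rmorphD.
by rewrite mulmxDr mulmxDl mul_mx_scalar -scalemxAl UU scalemx1.
Qed.

Lemma eigenvalues_shift n (M : 'M[R[i]]_n) c i : M^t* = M -> (i < n)%N ->
  (eigenvalues (M + c%:C%:M))`_i = (eigenvalues M)`_i + c.
Proof.
move=> /herm_spectral[U UU {1}->] lt_in; have UU' := mulmx1C UU.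
rewrite spectral_diagR_shift ?size_eigenvalues //.
rewrite eigenvalues_diagR ?size_map ?size_eigenvalues //.
rewrite sorted_sort.
- by rewrite (nth_map 0) ?size_eigenvalues.
- exact: ge_trans.
- apply: homo_sorted (sorted_eigenvalues M) => x y.
  by rewrite /= lerD2r.
Qed.

Lemma eigenvalues_1sub n (M : 'M[R[i]]_n) : M^t* = M ->
  eigenvalues (1%:M - M) = rev [seq 1 - x | x <- eigenvalues M].
Proof.
move=> /herm_spectral[U UU eM]; have UU' := mulmx1C UU.
have -> : 1%:M - M = U *m diagR n [seq 1 - x | x <- eigenvalues M] *m U^t*.
  have -> : diagR n [seq 1 - x | x <- eigenvalues M] =
      1%:M - diagR n (eigenvalues M).
    rewrite /diagR -diag_const_mx -linearB /=; congr diag_mx.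
    by apply/rowP => i; rewrite !mxE (nth_map 0) ?size_eigenvalues // rmorphB.
  by rewrite mulmxBr mulmxBl mulmx1 UU' -eM.
rewrite eigenvalues_diagR ?size_map ?size_eigenvalues //.
set s := map _ _; have /perm_sortP <- : perm_eq (rev s) s by rewrite perm_rev.
- rewrite sorted_sort //.
    exact: ge_trans.
  rewrite rev_sorted; apply: homo_sorted (sorted_eigenvalues M) => x y.
  by rewrite /= lerD2l lerN2.
- exact: ge_total.
- exact: ge_trans.
- exact: ge_anti.
Qed.

Lemma adj_scalar n (c : R) : (c%:C%:M : 'M[R[i]]_n)^t* = c%:C%:M.
Proof. by rewrite tr_scalar_mx map_scalar_mx /= conjC_real. Qed.

Lemma eigenvalues_psd n (M : 'M[R[i]]_n) i : M^t* = M ->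
  (forall v, 0 <= qf M v) -> 0 <= (eigenvalues M)`_i.
Proof.
move=> hM M0; have [lt_in|le_ni] := ltnP i n; last first.
  by rewrite nth_default // size_eigenvalues.
have [U UU eM] := herm_spectral hM.
have := M0 (U *m delta_mx (Ordinal lt_in) 0).
rewrite {1}eM qf_spectral mulmxA UU mul1mx (bigD1 (Ordinal lt_in)) //= big1.
  by rewrite mxE !eqxx /sqmod rmorph1 mulr1 /= mulr1 addr0.
move=> j ji; rewrite mxE eqxx andbT (_ : (j == _) = false) ?sqmod0 ?mulr0 //.
exact: negbTE.
Qed.

End QuadraticForm.

(** * Summation by parts *)

Section Sums.
Variable R : realType.

Lemma sum_ord_ltnC (a b : nat) (F : nat -> R) :
  \sum_(i < a | (i < b)%N) F i = \sum_(i < b | (i < a)%N) F i.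
Proof.
rewrite (big_ord_widen_cond _ (fun i => i < b)%N F (leq_addr b a)).
rewrite (big_ord_widen_cond _ (fun i => i < a)%N F (leq_addl a b)).
by apply: eq_bigl => i; rewrite andbC.
Qed.

Lemma abel_sum_le n (p x t : nat -> R) :
  (forall i, (i.+1 < n)%N -> p i.+1 <= p i) ->
  (forall i, (i < n)%N -> 0 <= p i) ->
  (forall s, (s <= n)%N -> \sum_(i < s) x i <= \sum_(i < s) t i) ->
  \sum_(i < n) p i * x i <= \sum_(i < n) p i * t i.
Proof.
case: n => [|n] pdec p0 hs; first by rewrite !big_ord0.
(* The induction needs a stronger claim: the difference of the weighted sums is at least [p m] times
   the difference of the plain ones, which is nonnegative. *)
suff H m : (m <= n)%N -> p m * (\sum_(i < m.+1) t i - \sum_(i < m.+1) x i) <=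
    \sum_(i < m.+1) p i * t i - \sum_(i < m.+1) p i * x i.
  rewrite -subr_ge0; apply: le_trans (H n (leqnn _)).
  by rewrite mulr_ge0 ?p0 // subr_ge0 hs.
elim: m => [|m IH] mn; first by rewrite !big_ord_recr !big_ord0 /=; lra.
have := IH (ltnW mn).
have hD : p m.+1 * (\sum_(i < m.+1) t i - \sum_(i < m.+1) x i) <=
    p m * (\sum_(i < m.+1) t i - \sum_(i < m.+1) x i).
  by rewrite ler_wpM2r ?pdec // subr_ge0 hs // ltnW.
rewrite ![\sum_(i < m.+2) _]big_ord_recr /=; move: hD.
set X := \sum_(i < m.+1) x i; set T := \sum_(i < m.+1) t i.
set PT := \sum_(i < _) _; set PX := \sum_(i < _) _ => h1 h2.
have subDD (a b c d : R) : a + b - (c + d) = (a - c) + (b - d) by ring.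
rewrite !subDD mulrDr -mulrBr lerD2r.
exact: le_trans h2.
Qed.

End Sums.

(** * Lidskii's inequality and eigenvalue sums of congruences *)

Section EigenvalueInequalities.
Local Opaque eigenvalues.
Variable R : realType.
Implicit Types (m n : nat).

(** [F] is the positive part of [E - mu], built in an eigenbasis of [E]. *)
Lemma positive_part n (E : 'M[R[i]]_n) mu : E^t* = E ->
  exists F : 'M[R[i]]_n, [/\ F^t* = F, forall v, 0 <= qf F v,
    forall v, qf E v <= qf F v + mu * qf 1%:M v &
    complex.Re (\tr F) = \sum_(i < n) Num.max ((eigenvalues E)`_i - mu) 0].
Proof.
move=> hE; have [U UU eE] := herm_spectral hE; have UU' := mulmx1C UU.
pose f := mkseq (fun i => Num.max ((eigenvalues E)`_i - mu) 0) n.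
have fE (i : 'I_n) : f`_i = Num.max ((eigenvalues E)`_i - mu) 0.
  by rewrite nth_mkseq.
exists (U *m diagR n f *m U^t*); split.
- by rewrite !adjmxM trmxCK adj_diagR mulmxA.
- move=> v; rewrite qf_spectral; apply: sumr_ge0 => i _.
  by rewrite mulr_ge0 ?sqmod_ge0 // fE le_max lexx orbT.
- move=> v; have hU : (U^t*)^t* *m U^t* = 1%:M by rewrite trmxCK.
  rewrite {1}eE -(qf1_isometry v hU) !qf_spectral qf1 mulr_sumr -big_split /=.
  apply: ler_sum => i _; rewrite -mulrDl ler_wpM2r ?sqmod_ge0 //.
  by rewrite fE -lerBlDr le_max lexx.
- by rewrite trace_diagR //; apply: eq_bigr => i _.
Qed.

(* Li and Mathias: shifting [E] so that its [#|I|]-th eigenvalue is [0] and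
   then replacing it by its positive part makes every summand nonnegative, so
   that the sum over [I] is bounded by the trace of the positive part. *)
Lemma lidskii n (B E : 'M[R[i]]_n) (I : {set 'I_n}) : B^t* = B -> E^t* = E ->
  \sum_(i in I) ((eigenvalues (B + E))`_i - (eigenvalues B)`_i) <=
  \sum_(i < #|I|) (eigenvalues E)`_i.
Proof.
move=> hB hE; have [I0|Ipos] := posnP #|I|.
  by rewrite (cards0_eq I0) big_set0 cards0 big_ord0.
have In : (#|I| <= n)%N by rewrite -[n in (_ <= n)%N]card_ord max_card.
pose mu := (eigenvalues E)`_(#|I|.-1).
have [F [hF F0 EF trF]] := positive_part mu hE.
have hBF : (B + F)^t* = B + F by rewrite adjmxD hB hF.
have hBE : (B + E)^t* = B + E by rewrite adjmxD hB hE.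
have le_F (i : 'I_n) : (eigenvalues B)`_i <= (eigenvalues (B + F))`_i.
  apply: (eigenvalues_mono hB hBF) (ltn_ord i) => v.
  by rewrite qfD lerDl.
have le_E (i : 'I_n) :
    (eigenvalues (B + E))`_i <= (eigenvalues (B + F))`_i + mu.
  rewrite -(eigenvalues_shift mu hBF (ltn_ord i)).
  apply: (eigenvalues_mono hBE _ _ (ltn_ord i)).
    by rewrite adjmxD hBF adj_scalar.
  by move=> v; rewrite !qfD qf_scalar -addrA lerD2l.
apply: (@le_trans _ _ (\sum_(i in I)
    (mu + ((eigenvalues (B + F))`_i - (eigenvalues B)`_i)))).
  apply: ler_sum => i _; rewrite addrA lerD2r addrC; exact: le_E.
rewrite big_split /= sumr_const.
apply: (@le_trans _ _ (mu *+ #|I| +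
    \sum_(i < n) ((eigenvalues (B + F))`_i - (eigenvalues B)`_i))).
  rewrite lerD2l [leRHS](bigID (mem I)) /= lerDl.
  by apply: sumr_ge0 => i _; rewrite subr_ge0.
rewrite sumrB -[X in _ + (X - _)](trace_eigenvalues hBF).
rewrite -(trace_eigenvalues hB).
rewrite mxtraceD ReD addrAC subrr add0r.
rewrite trF.
(* The spectrum of [E] is sorted: entries of index below [#|I|] are at least [mu], later ones at
   most [mu], so only the former contribute. *)
have -> : \sum_(i < n) Num.max ((eigenvalues E)`_i - mu) 0 =
    \sum_(i < #|I|) ((eigenvalues E)`_i - mu).
  rewrite [RHS](big_ord_widen _ (fun i => (eigenvalues E)`_i - mu) In).
  rewrite [LHS](bigID (fun i : 'I_n => (i < #|I|)%N)) /= [X in _ + X]big1.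
    rewrite addr0; apply: eq_bigr => i iI.
    apply/max_idPl; rewrite subr_ge0 le_eigenvalues //.
    by rewrite -ltnS prednK // iI.
  move=> i; rewrite -leqNgt => Ii; apply/max_idPr.
  by rewrite subr_le0 le_eigenvalues // ltn_ord andbT (leq_trans (leq_pred _)).
by rewrite sumrB sumr_const card_ord addrC subrK.
Qed.

Lemma mul_selmx s n p (sn : (s <= n)%N) (A : 'M[R[i]]_(n, p)) :
  selmx R s 0 n *m A = \matrix_(q, c) A (widen_ord sn q) c.
Proof.
apply/matrixP=> q c; rewrite !mxE (bigD1 (widen_ord sn q)) //= big1.
  by rewrite mxE addn0 eqxx mul1r addr0.
move=> l lq; rewrite mxE addn0 (_ : (_ == _) = false) ?mul0r //.
exact: negbTE.
Qed.

Lemma selmx_isometry s n : (s <= n)%N ->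
  (selmx R s 0 n)^t*^t* *m (selmx R s 0 n)^t* = 1%:M.
Proof.
move=> sn; rewrite trmxCK mul_selmx; apply/matrixP=> q c.
by rewrite !mxE /= addn0 rmorph_nat eqE.
Qed.

Lemma Re_tr_gram m n (K : 'M[R[i]]_(n, m)) :
  complex.Re (\tr (K^t* *m K)) = \sum_(l < n) \sum_(c < m) sqmod (K l c).
Proof.
rewrite /mxtrace Re_sum exchange_big /=; apply: eq_bigr => c _.
rewrite mxE Re_sum; apply: eq_bigr => l _.
by rewrite !mxE.
Qed.

Lemma adj_gram m n (K : 'M[R[i]]_(n, m)) : (K^t* *m K)^t* = K^t* *m K.
Proof. by rewrite adjmxM trmxCK. Qed.

Lemma adj_conj m n (P : 'M[R[i]]_n) (K : 'M_(n, m)) : P^t* = P ->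
  (K^t* *m P *m K)^t* = K^t* *m P *m K.
Proof. by move=> hP; rewrite !adjmxM trmxCK hP mulmxA. Qed.

Lemma qf_gram_ge0 m n (K : 'M[R[i]]_(n, m)) v : 0 <= qf (K^t* *m K) v.
Proof. by rewrite qf_gram qf1_ge0. Qed.

(** The left side is the trace of the Gram matrix of the first [s] rows of [K]. Interlacing bounds
    its eigenvalues by those of [T]; as its rank is at most [s], those from index [s] on are not
    positive. *)
Lemma sum_rows_gram_le m n j s (K : 'M[R[i]]_(n, j)) (T : 'M_m)
    (Q : 'M_(m, j)) :
  (s <= n)%N -> T^t* = T -> Q^t* *m Q = 1%:M ->
  (forall v, qf (K^t* *m K) v <= qf T (Q *m v)) ->
  \sum_(l < n | (l < s)%N) \sum_(c < j) sqmod (K l c) <=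
  \sum_(i < j | (i < s)%N) (eigenvalues T)`_i.
Proof.
move=> sn hT hQ hK; pose K' := selmx R s 0 n *m K.
have K'E : K' = \matrix_(q, c) K (widen_ord sn q) c by apply: mul_selmx.
have -> : \sum_(l < n | (l < s)%N) \sum_(c < j) sqmod (K l c) =
    complex.Re (\tr (K'^t* *m K')).
  rewrite Re_tr_gram (big_ord_narrow sn); apply: eq_bigr => q _.
  by apply: eq_bigr => c _; rewrite K'E mxE.
rewrite trace_eigenvalues ?adj_gram //.
rewrite [leLHS](bigID (fun i : 'I_j => i < s)%N) /=.
rewrite -[leRHS]addr0; apply: lerD.
  apply: ler_sum => i _.
  apply: (eigenvalues_interlacing (adj_gram K') hT hQ _ (ltn_ord i)).
  move=> v; apply: le_trans (hK v); rewrite !qf_gram !qf1.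
  rewrite [leRHS](bigID (fun i : 'I_n => i < s)%N) /= (big_ord_narrow sn).
  rewrite ler_wpDr ?sumr_ge0 //; first by move=> l _; apply: sqmod_ge0.
  by apply: ler_sum => q _; rewrite /K' -mulmxA mul_selmx mxE.
apply: sumr_le0 => i; rewrite -leqNgt => si.
apply: (@eigenvalues_le_codim _ _ _ _ K').
- exact: adj_gram.
- by rewrite si ltn_ord.
- by move=> v K'v; rewrite qf_gram K'v mul0r /qf mulmx0 mxE.
Qed.

(* Summation by parts over the eigenvalues of [P] reduces the bound to the case
   where [P] is a spectral projection of some rank [s]; then [T^* P T] lies
   below [T^* T] and has at most [s] nonzero eigenvalues. *)
Lemma eigenvalues_sum_conj_le m n j (P : 'M[R[i]]_n) (T : 'M_(n, m)) :
  (j <= m)%N -> P^t* = P -> (forall v, 0 <= qf P v) ->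
  \sum_(i < j) (eigenvalues (T^t* *m P *m T))`_i <=
  \sum_(i < j) (eigenvalues P)`_i * (eigenvalues (T^t* *m T))`_i.
Proof.
move=> jm hP P0; set M := T^t* *m P *m T.
have hM : M^t* = M by apply: adj_conj.
have [W WW eM] := herm_spectral hM.
have [U UU eP] := herm_spectral hP; have UU' := mulmx1C UU.
(* [Q] consists of the first [j] eigenvectors of [M]; [K] holds the coordinates of their images
   under [T] in the eigenbasis of [P]. *)
pose S := (selmx R j 0 m)^t*.
have hS : S^t* *m S = 1%:M by apply: selmx_isometry.
pose Q := W *m S.
have hQ : Q^t* *m Q = 1%:M.
  by rewrite /Q adjmxM mulmxA -(mulmxA _ _ W) WW mulmx1.
pose K := U^t* *m (T *m Q).
have KP : K^t* *m diagR n (eigenvalues P) *m K = Q^t* *m M *m Q.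
  by rewrite /M {2}eP /K (adjmxM (U^t*)) (adjmxM T) trmxCK !mulmxA.
(* Both sides are the trace of [Q^t* *m M *m Q]; on the right it weights the squared norms of the
   rows of [K] by the eigenvalues of [P]. *)
have -> : \sum_(i < j) (eigenvalues M)`_i =
    \sum_(l < n) (eigenvalues P)`_l * \sum_(c < j) sqmod (K l c).
  transitivity (complex.Re (\tr (Q^t* *m M *m Q))).
    rewrite {2}eM /Q adjmxM !mulmxA -[_ *m W^t* *m W]mulmxA WW mulmx1.
    rewrite -[_ *m W^t* *m W]mulmxA WW mulmx1 /S trmxCK -mulmxA mul_selmx.
    rewrite /mxtrace Re_sum; apply: eq_bigr => i _.
    rewrite mul_diag_mx !mxE ReM_real /= addn0 eqxx rmorph1 mulr1 //.
  rewrite -KP /mxtrace Re_sum.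
  under eq_bigr do rewrite mxE Re_sum.
  rewrite exchange_big /=; apply: eq_bigr => l _; rewrite mulr_sumr.
  apply: eq_bigr => c _.
  by rewrite mul_mx_diag !mxE mulrAC mulrC ReM_real.
pose t i := if (i < j)%N then (eigenvalues (T^t* *m T))`_i else 0.
pose x i := if insub i is Some l then \sum_(c < j) sqmod (K l c) else 0.
have xE (l : 'I_n) : x l = \sum_(c < j) sqmod (K l c) by rewrite /x valK.
under eq_bigr do rewrite -xE.
apply: (@le_trans _ _ (\sum_(l < n) (eigenvalues P)`_l * t l)).
  apply: (@abel_sum_le _ _ (fun l => (eigenvalues P)`_l)) => [i hi|i _|s sn].
  - by apply: le_eigenvalues; rewrite leqnSn.
  - exact: eigenvalues_psd.
  rewrite (big_ord_widen _ _ sn).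
  under eq_bigr do rewrite xE.
  rewrite /t -big_mkcond sum_ord_ltnC.
  apply: (@sum_rows_gram_le _ _ _ _ _ _ Q) => //; first exact: adj_gram.
  move=> v; rewrite !qf_gram /K -mulmxA qf1_isometry ?mulmxA //.
  by rewrite trmxCK.
rewrite /t; under eq_bigr do rewrite fun_if mulr0.
rewrite -big_mkcond /=.
rewrite (sum_ord_ltnC _ _
  (fun i => (eigenvalues P)`_i * (eigenvalues (T^t* *m T))`_i)).
(* If [j] exceeds [n], the entries of the spectrum of [P] from index [n] on are the default 0. *)
rewrite [leRHS](bigID (fun i : 'I_j => i < n)%N) /=.
rewrite [X in _ + X]big1 ?addr0 // => i; rewrite -leqNgt => ni.
by rewrite nth_default ?mul0r // size_eigenvalues.
Qed.

End EigenvalueInequalities.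

(** * Ritz values of an invariant subspace *)

Section RayleighRitz.
Variable R : realType.
Implicit Types (m n k : nat).
Local Opaque eigenvalues.

Lemma psd_sqrt n (A : 'M[R[i]]_n) : A^t* = A -> (forall v, 0 <= qf A v) ->
  exists2 H : 'M[R[i]]_n, H^t* = H & H *m H = A.
Proof.
move=> hA A0; have [U UU eA] := herm_spectral hA.
pose s := [seq Num.sqrt x | x <- eigenvalues A].
have ss : diagR n s *m diagR n s = diagR n (eigenvalues A).
  rewrite mulmx_diag; congr diag_mx; apply/rowP => i; rewrite !mxE.
  rewrite (nth_map 0) ?size_eigenvalues // -rmorphM -expr2 sqr_sqrtr //.
  exact: eigenvalues_psd.
exists (U *m diagR n s *m U^t*).
  by rewrite !adjmxM trmxCK adj_diagR mulmxA.
rewrite [RHS]eA -ss !mulmxA -(mulmxA _ (U^t*) U) UU mulmx1.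
reflexivity.
Qed.

(** Pythagoras for Gram matrices: [Y - X *m (X^t* *m Y)] is the part of [Y] orthogonal to the
    columns of [X]. *)
Lemma gram_complement n k (X Y : 'M[R[i]]_(n, k)) :
  X^t* *m X = 1%:M -> Y^t* *m Y = 1%:M ->
  (Y - X *m (X^t* *m Y))^t* *m (Y - X *m (X^t* *m Y)) =
  1%:M - (X^t* *m Y)^t* *m (X^t* *m Y).
Proof.
move=> hX hY; set C := X^t* *m Y.
have CE : Y^t* *m X = C^t* by rewrite /C adjmxM trmxCK.
rewrite adjmxD adjmxN adjmxM mulmxDl mulNmx !mulmxBr hY.
rewrite (mulmxA _ X) CE -!(mulmxA (C^t*)) -/C (mulmxA _ X) hX mul1mx.
by rewrite subrr subr0.
Qed.

(** [X'] and [T'] stand for adjoints. The columns of [X] span a reducing subspace orthogonal to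
    those of [T], so the cross terms vanish. *)
Lemma conj_reducing (K : nzRingType) n k (A : 'M[K]_n) (A1 C C' : 'M_k)
    (X T : 'M_(n, k)) (X' T' : 'M_(k, n)) :
  A *m X = X *m A1 -> X' *m A = A1 *m X' -> X' *m X = 1%:M ->
  X' *m T = 0 -> T' *m X = 0 ->
  (C' *m X' + T') *m A *m (X *m C + T) = C' *m A1 *m C + T' *m A *m T.
Proof.
move=> AX X'A X'X X'T T'X; rewrite !mulmxDl !mulmxDr.
rewrite -(mulmxA C') X'A -(mulmxA C' _ T) -(mulmxA A1 _ T) X'T !mulmx0 addr0.
rewrite -(mulmxA T' A (X *m C)) (mulmxA A) AX -(mulmxA X) (mulmxA T') T'X.
rewrite mul0mx add0r (mulmxA C') -(mulmxA _ X') (mulmxA X') X'X mul1mx.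
reflexivity.
Qed.

Lemma eigenvalues_1sub_gramC k (C : 'M[R[i]]_k) :
  eigenvalues (1%:M - C *m C^t*) = eigenvalues (1%:M - C^t* *m C).
Proof.
rewrite !eigenvalues_1sub ?adj_gram ?(eigenvalues_mulmxC C) //.
by rewrite adjmxM trmxCK.
Qed.

(** A common lower bound [c] gives [|a - b| <= (a - c) + (b - c)], so the two changes can be
    estimated separately. *)
Lemma sum_norm_sub_le (I : finType) (D : {set I}) (a b c : I -> R) p q :
  (forall i, c i <= a i) -> (forall i, c i <= b i) ->
  \sum_(i in D) (a i - c i) <= p -> \sum_(i in D) (b i - c i) <= q ->
  \sum_(i in D) `|a i - b i| <= p + q.
Proof.
move=> ca cb hp hq; apply: le_trans (lerD hp hq); rewrite -big_split /=.
apply: ler_sum => i _.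
have := ca i; have := cb i => h1 h2.
by rewrite ler_norml; apply/andP; split; lra.
Qed.

Lemma sum_dist_shift (I J : finType) (D : {set I}) (a b a' b' : I -> R)
    (l l' t : J -> R) (c : R) :
  (forall i, a' i = a i + c) -> (forall i, b' i = b i + c) ->
  (forall j, l' j = l j + c) ->
  \sum_(i in D) `|a' i - b' i| <= \sum_j 2 * (l' j * t j) ->
  \sum_(i in D) `|a i - b i| <= \sum_j 2 * ((l j + c) * t j).
Proof.
move=> a'E b'E l'E; under eq_bigr do rewrite a'E b'E opprD addrACA subrr addr0.
by under [leRHS]eq_bigr do rewrite l'E.
Qed.

Lemma sum_dist_eigenvalues_psd n k (A : 'M[R[i]]_n) (X Y : 'M[R[i]]_(n, k))
    (D : {set 'I_k}) :
  A^t* = A -> (forall v, 0 <= qf A v) ->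
  X^t* *m X = 1%:M -> Y^t* *m Y = 1%:M ->
  A *m X = X *m (X^t* *m A *m X) ->
  \sum_(i in D) `|(eigenvalues (X^t* *m A *m X))`_i -
                  (eigenvalues (Y^t* *m A *m Y))`_i| <=
  \sum_(i < #|D|) 2 * ((eigenvalues A)`_i *
    (eigenvalues (1%:M - (X^t* *m Y)^t* *m (X^t* *m Y)))`_i).
Proof.
move=> hA A0 hX hY; set A1 := X^t* *m A *m X => AX.
have hA1 : A1^t* = A1 by apply: adj_conj.
have A10 v : 0 <= qf A1 v by rewrite /A1 qf_conj.
have A1_le (i : 'I_k) : (eigenvalues A1)`_i <= (eigenvalues A)`_i.
  apply: (eigenvalues_interlacing hA1 hA hX _ (ltn_ord i)) => v.
  by rewrite /A1 qf_conj.
have Dk : (#|D| <= k)%N by rewrite -[k in (_ <= k)%N]card_ord max_card.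
have TT := gram_complement hX hY; have SS := gram_complement hY hX.
set C := X^t* *m Y in TT *.
have CE : Y^t* *m X = C^t* by rewrite /C adjmxM trmxCK.
rewrite CE trmxCK in SS.
set T := Y - X *m C in TT; set S := X - Y *m C^t* in SS.
have XT : X^t* *m T = 0 by rewrite /T mulmxBr -/C mulmxA hX mul1mx subrr.
have TX : T^t* *m X = 0.
  by rewrite -[LHS]trmxCK adjmxM trmxCK XT trmx0 map_mx0.
have YXT : Y = X *m C + T by rewrite addrC subrK.
clearbody C T S A1.
have [H hH HH] := psd_sqrt hA1 A10.
(* [N] links the two spectra: [N^t* *m N] lies below [Y^t* *m A *m Y], and the isospectral
   [N *m N^t*] lies below [A1]. *)
pose N := H *m C.
have hNN : (N *m N^t*)^t* = N *m N^t* by rewrite adjmxM trmxCK.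
have hN'N : (N^t* *m N)^t* = N^t* *m N := adj_gram N.
have NN : N^t* *m N = C^t* *m A1 *m C.
  by rewrite /N adjmxM hH -HH !mulmxA.
have YE : Y^t* *m A *m Y = N^t* *m N + T^t* *m A *m T.
  have XA : X^t* *m A = A1 *m X^t*.
    by rewrite -[LHS]trmxCK adjmxM trmxCK hA AX adjmxM hA1.
  rewrite [in LHS]YXT adjmxD adjmxM NN.
  exact: conj_reducing AX XA hX XT TX.
have A1E : N *m N^t* + H *m (S^t* *m S) *m H = A1.
  rewrite SS /N adjmxM hH mulmxBr mulmxBl mulmx1 HH !mulmxA.
  by rewrite addrC subrK.
have NC : eigenvalues (N *m N^t*) = eigenvalues (N^t* *m N).
  exact: eigenvalues_mulmxC.
have hE1 : (H *m (S^t* *m S) *m H)^t* = H *m (S^t* *m S) *m H.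
  by rewrite -{1 3}hH; apply: adj_conj; apply: adj_gram.
have hE2 : (T^t* *m A *m T)^t* = T^t* *m A *m T by apply: adj_conj.
have E10 v : 0 <= qf (H *m (S^t* *m S) *m H) v.
  by rewrite -{1}hH qf_conj qf_gram_ge0.
have E20 v : 0 <= qf (T^t* *m A *m T) v by rewrite qf_conj.
have hYAY : (Y^t* *m A *m Y)^t* = Y^t* *m A *m Y by apply: adj_conj.
have S_psd i : 0 <= (eigenvalues (S^t* *m S))`_i.
  by apply: eigenvalues_psd; [exact: adj_gram | move=> v; exact: qf_gram_ge0].
(* The parts of [X] orthogonal to [Y] and of [Y] orthogonal to [X] thus have the same sines. *)
have evS : eigenvalues (S^t* *m S) = eigenvalues (T^t* *m T).
  rewrite SS TT; exact: eigenvalues_1sub_gramC.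
rewrite -TT -mulr_sumr mulr_natl mulr2n.
apply: (@sum_norm_sub_le _ _ _ _
  (fun i : 'I_k => (eigenvalues (N^t* *m N))`_i)).
- move=> i; rewrite -NC; apply: (eigenvalues_mono hNN hA1 _ (ltn_ord i)) => v.
  by rewrite -A1E qfD lerDl.
- move=> i; apply: (eigenvalues_mono hN'N hYAY _ (ltn_ord i)) => v.
  by rewrite YE qfD lerDl.
(* The bound for congruences is applied to [S^t* *m S] conjugated by [H]; the other factor is the
   spectrum of [H *m H = A1], which lies below that of [A]. *)
- rewrite -NC -{1}A1E; apply: le_trans (lidskii _ hNN hE1) _.
  have := eigenvalues_sum_conj_le H Dk (adj_gram S) (@qf_gram_ge0 _ _ _ S).
  rewrite hH HH evS => /le_trans; apply.
  apply: ler_sum => i _; rewrite mulrC.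
  apply: ler_wpM2r; first by rewrite -evS; exact: S_psd.
  exact: (A1_le (widen_ord Dk i)).
- rewrite YE; apply: le_trans (lidskii _ hN'N hE2) _.
  exact: eigenvalues_sum_conj_le.
Qed.

Lemma qf_ge_last n (A : 'M[R[i]]_n) v : A^t* = A ->
  last 0 (eigenvalues A) * qf 1%:M v <= qf A v.
Proof.
move=> hA; have [U UU eA] := herm_spectral hA; have UU' := mulmx1C UU.
have hU : (U^t*)^t* *m U^t* = 1%:M by rewrite trmxCK.
rewrite [in leRHS]eA -(qf1_isometry v hU) qf_spectral qf1 mulr_sumr.
apply: ler_sum => i _; rewrite ler_wpM2r ?sqmod_ge0 //.
rewrite -nth_last size_eigenvalues.
have n0 := leq_ltn_trans (leq0n i) (ltn_ord i).
by rewrite le_eigenvalues // -ltnS prednK // ltn_ord leqnn.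
Qed.

(** Subtracting the least eigenvalue makes [A] positive semidefinite and shifts all three spectra
    equally, which leaves the distances unchanged. *)
Lemma sum_dist_eigenvalues n k (A : 'M[R[i]]_n) (X Y : 'M[R[i]]_(n, k))
    (D : {set 'I_k}) :
  A^t* = A -> X^t* *m X = 1%:M -> Y^t* *m Y = 1%:M ->
  A *m X = X *m (X^t* *m A *m X) ->
  \sum_(i in D) `|(eigenvalues (X^t* *m A *m X))`_i -
                  (eigenvalues (Y^t* *m A *m Y))`_i| <=
  \sum_(i < #|D|) 2 * (((eigenvalues A)`_i - last 0 (eigenvalues A)) *
    (eigenvalues (1%:M - (X^t* *m Y)^t* *m (X^t* *m Y)))`_i).
Proof.
move=> hA hX hY AX; set mu := last 0 (eigenvalues A).
pose A' := A + (- mu)%:C%:M.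
have hA' : A'^t* = A' by rewrite adjmxD hA adj_scalar.
have A'0 v : 0 <= qf A' v.
  by rewrite qfD qf_scalar mulNr subr_ge0; apply: qf_ge_last.
have conjA' (Z : 'M_(n, k)) : Z^t* *m Z = 1%:M ->
    Z^t* *m A' *m Z = Z^t* *m A *m Z + (- mu)%:C%:M.
  by move=> hZ; rewrite mulmxDr mulmxDl mul_mx_scalar -scalemxAl hZ scalemx1.
have A'X : A' *m X = X *m (X^t* *m A' *m X).
  by rewrite conjA' // mulmxDr -AX mulmxDl mul_mx_scalar mul_scalar_mx.
have Dk : (#|D| <= k)%N by rewrite -[k in (_ <= k)%N]card_ord max_card.
have kn : (k <= n)%N by apply: mulmx1_min hX.
have eigX (i : 'I_k) : (eigenvalues (X^t* *m A' *m X))`_i =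
    (eigenvalues (X^t* *m A *m X))`_i - mu.
  rewrite (conjA' X hX).
  exact: (eigenvalues_shift _ (adj_conj _ hA) (ltn_ord i)).
have eigY (i : 'I_k) : (eigenvalues (Y^t* *m A' *m Y))`_i =
    (eigenvalues (Y^t* *m A *m Y))`_i - mu.
  rewrite (conjA' Y hY).
  exact: (eigenvalues_shift _ (adj_conj _ hA) (ltn_ord i)).
have eigA (i : 'I_#|D|) : (eigenvalues A')`_i = (eigenvalues A)`_i - mu.
  apply: (eigenvalues_shift _ hA).
  by rewrite (leq_trans (ltn_ord i)) // (leq_trans Dk).
exact: (sum_dist_shift eigX eigY eigA
  (sum_dist_eigenvalues_psd D hA' A'0 hX hY A'X)).
Qed.

End RayleighRitz.

(** * Majorization and principal angles *)

Section Majorization.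
Variable R : realType.
Implicit Types (s : seq R) (j k : nat).

Lemma sum_nth_take s j : (j <= size s)%N ->
  \sum_(i < j) s`_i = \sum_(x <- take j s) x.
Proof.
move=> js; rewrite (big_nth 0) size_takel // big_mkord.
by apply: eq_bigr => i _; rewrite nth_take.
Qed.

(** With [mu] the last of the leading sorted entries, the sum of the positive parts of [x - mu] over
    the whole list ignores the order and lies between the two shifted sums. *)
Lemma sum_nth_le_sort s j : (j <= size s)%N ->
  \sum_(i < j) s`_i <= \sum_(i < j) (sort >=%R s)`_i.
Proof.
case: j => [|j] js; first by rewrite !big_ord0.
set z := sort _ s; have sz : size z = size s by rewrite size_sort.
pose mu := z`_j.
have zdec i l : (i <= l < size s)%N -> z`_l <= z`_i.
  move=> /andP[il ls]; apply: (@sorted_leq_nth _ >=%R) => //.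
  - exact: ge_trans.
  - exact: ge_refl.
  - exact: (sort_sorted ge_total).
  - by rewrite inE sz (leq_ltn_trans il).
  - by rewrite inE sz.
suff : \sum_(i < j.+1) (s`_i - mu) <= \sum_(i < j.+1) (z`_i - mu).
  by rewrite !sumrB lerD2r.
apply: (@le_trans _ _ (\sum_(x <- s) Num.max (x - mu) 0)).
  rewrite [leRHS](big_nth 0) big_mkord.
  rewrite [leLHS](big_ord_widen _ (fun i => s`_i - mu) js).
  rewrite [leRHS](bigID (fun i : 'I_(size s) => (i < j.+1)%N)) /=.
  rewrite ler_wpDr //.
    by apply: sumr_ge0 => i _; rewrite le_max lexx orbT.
  by apply: ler_sum => i _; rewrite le_max lexx.
have <- : \sum_(x <- z) Num.max (x - mu) 0 = \sum_(x <- s) Num.max (x - mu) 0.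
  by apply: perm_big; rewrite perm_sort.
rewrite [leLHS](big_nth 0) big_mkord sz.
rewrite [leRHS](big_ord_widen _ (fun i => z`_i - mu) js).
rewrite [leLHS](bigID (fun i : 'I_(size s) => (i < j.+1)%N)) /=.
rewrite [X in _ + X]big1 ?addr0.
  apply: ler_sum => i ij; rewrite ge_max lexx /= subr_ge0 zdec //.
  by rewrite -ltnS ij js.
move=> i; rewrite -leqNgt => ji; apply/max_idPr; rewrite subr_le0 zdec //.
by rewrite ltn_ord andbT ltnW.
Qed.

Lemma sort_sum_subset k (f : 'I_k -> R) j : (j <= k)%N ->
  exists2 D : {set 'I_k}, #|D| = j &
    \sum_(i < j) (sort >=%R [seq f l | l <- enum 'I_k])`_i = \sum_(i in D) f i.
Proof.
move=> jk; rewrite sort_map; set t := sort _ _.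
have st : size t = k by rewrite size_sort size_enum_ord.
have ut : uniq (take j t) by rewrite take_uniq // sort_uniq enum_uniq.
exists [set l in take j t].
  by rewrite cardsE (card_uniqP ut) size_takel // st.
rewrite sum_nth_take ?size_map ?st // -map_take big_map big_uniq //.
by apply: eq_bigl => l; rewrite inE.
Qed.

(** A leading sum of the sorted [x] is a sum over some subset, and sorting [g] can only increase its
    leading sums. *)
Lemma submajorized_subsets k (x : 'rV[R]_k) (g : nat -> R) :
  (forall D : {set 'I_k}, \sum_(i in D) x 0 i <= \sum_(i < #|D|) g i) ->
  submajorized x (\row_(i < k) g i).
Proof.
move=> h j /andP[_ jk].
have [D Dj ->] := sort_sum_subset (fun l => x 0 l) jk.
apply: le_trans (h D) _; rewrite Dj.
have -> : \sum_(i < j) g i =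
    \sum_(i < j) [seq (\row_(i < k) g i) 0 l | l <- enum 'I_k]`_i.
  apply: eq_bigr => i _; have ik := leq_trans (ltn_ord i) jk.
  rewrite (nth_map (Ordinal ik)) ?size_enum_ord // mxE.
  by rewrite (nth_enum_ord _ ik).
by apply: sum_nth_le_sort; rewrite size_map size_enum_ord.
Qed.

End Majorization.

(** * Sines and cosines of the principal angles *)

Section PrincipalAngles.
Variable R : realType.
Local Opaque eigenvalues.

Lemma gram_mul_le1 d k (X Y : 'M[R[i]]_(d, k)) i :
  X^t* *m X = 1%:M -> Y^t* *m Y = 1%:M ->
  0 <= (eigenvalues (1%:M - (X^t* *m Y)^t* *m (X^t* *m Y)))`_i.
Proof.
move=> hX hY; rewrite -gram_complement //.
by apply: eigenvalues_psd; [exact: adj_gram | move=> v; exact: qf_gram_ge0].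
Qed.

Lemma principal_angles_sin_cos d k (X Y : 'M[R[i]]_(d, k)) :
  X^t* *m X = 1%:M -> Y^t* *m Y = 1%:M ->
  (principal_angles X Y)`_0 < pi / 2%:R ->
  forall i, (i < k)%N ->
  [/\ 0 < cos (principal_angles X Y)`_i, cos (principal_angles X Y)`_i <= 1 &
      sin (principal_angles X Y)`_i ^+ 2 =
      (eigenvalues (1%:M - (X^t* *m Y)^t* *m (X^t* *m Y)))`_i].
Proof.
move=> hX hY; set C := X^t* *m Y; set c := eigenvalues (C^t* *m C).
have sc : size c = k := size_eigenvalues _.
(* The angles are listed in reverse, so the angle of index [i], counted from 0, comes from the entry
   [k - i.+1] of [c]. *)
have angE i : (i < k)%N ->
    (principal_angles X Y)`_i = acos (Num.sqrt c`_(k - i.+1)).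
  have -> : principal_angles X Y =
      rev (map (fun x : R => acos (Num.sqrt x)) c).
    by rewrite /principal_angles /singular_values -map_comp.
  move=> ik.
  have lt : (k - i.+1 < k)%N by rewrite ltn_subrL (leq_ltn_trans _ ik).
  by rewrite nth_rev size_map sc // (nth_map 0) ?sc.
have sinE i : (i < k)%N ->
    (eigenvalues (1%:M - C^t* *m C))`_i = 1 - c`_(k - i.+1).
  move=> ik; rewrite eigenvalues_1sub ?adj_gram // -/c.
  have lt : (k - i.+1 < k)%N by rewrite ltn_subrL (leq_ltn_trans _ ik).
  by rewrite nth_rev size_map sc // (nth_map 0) ?sc.
have c0 i : 0 <= c`_i.
  by apply: eigenvalues_psd; [exact: adj_gram | move=> v; exact: qf_gram_ge0].
have c1 i : (i < k)%N -> c`_(k - i.+1) <= 1.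
  move=> ik; rewrite -subr_ge0 -(sinE _ ik); exact: gram_mul_le1.
have s01 i : (i < k)%N -> -1 <= Num.sqrt c`_(k - i.+1) <= 1.
  move=> ik; apply/andP; split.
    by apply: le_trans (sqrtr_ge0 _); rewrite lerN10.
  by rewrite -sqrtr1 ler_wsqrtr ?c1.
move=> Theta0 i ik; have k0 := leq_ltn_trans (leq0n i) ik.
(* Index 0 is the largest angle, whose cosine is the smallest singular value; its positivity passes
   to the others. *)
have cos0 : 0 < Num.sqrt c`_(k - 1).
  rewrite -(acosK (s01 0%N k0)); apply: cos_gt0_pihalf.
  rewrite -angE // Theta0 andbT angE //.
  rewrite (lt_le_trans _ (acos_ge0 (s01 _ k0))) //.
  by rewrite oppr_lt0 divr_gt0 ?pi_gt0.
rewrite (angE _ ik) (acosK (s01 _ ik)); split.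
- apply: lt_le_trans cos0 _; rewrite ler_wsqrtr //.
  apply: le_eigenvalues; rewrite leq_sub2l //=.
  by rewrite ltn_subrL.
- by have /andP[] := s01 i ik.
- rewrite (sin_acos (s01 _ ik)) (sinE _ ik) (sqr_sqrtr (c0 _)) sqr_sqrtr.
    reflexivity.
  by rewrite subr_ge0; exact: c1.
Qed.

End PrincipalAngles.

(** * Compression to a subspace *)

Section Compression.
Variables (R : realType) (d : nat).
Implicit Types (Z : {vspace 'cV[R[i]]_d}) (A : 'M[R[i]]_d).
Local Opaque eigenvalues.

Lemma mem_bigcapv_seq (K : fieldType) (vT : vectType K) (I : eqType)
    (s : seq I) (F : I -> {vspace vT}) v :
  (v \in (\bigcap_(u <- s) F u)%VS) = all (fun u => v \in F u) s.
Proof.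
elim: s => [|u s IH]; first by rewrite big_nil memvf.
by rewrite big_cons memv_cap IH.
Qed.

Lemma mem_orthocompl Z v :
  reflect (forall u, u \in Z -> u^t* *m v = 0) (v \in orthocompl Z).
Proof.
rewrite mem_bigcapv_seq; apply: (iffP allP) => h u.
  move=> /coord_vbasis ->; rewrite raddf_sum /= raddf_sum /= mulmx_suml.
  apply: big1 => l _; have := h _ (mem_nth 0 (_ : (l < size (vbasis Z))%N)).
  rewrite size_tuple => /(_ (ltn_ord l)); rewrite memv_ker lfunE /= => /eqP h0.
  by rewrite linearZ /= map_mxZ -scalemxAl h0 scaler0.
move=> /vbasis_mem /h h0; rewrite memv_ker lfunE /=; exact/eqP.
Qed.

Lemma mulmx_cV_inj (K : nzRingType) m n (M N : 'M[K]_(m, n)) :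
  (forall c : 'cV_n, M *m c = N *m c) -> M = N.
Proof.
move=> h; apply/matrixP=> i j.
by have /colP/(_ i) := h (delta_mx j 0); rewrite -!colE !mxE.
Qed.

(** A QR decomposition. [schmidt] orthonormalizes rows, hence the transposes; [G] is invertible
    since its rank is at least that of [B]. *)
Lemma gram_schmidt n (B : 'M[R[i]]_(d, n)) : row_free B^T ->
  exists W : 'M_(d, n), exists2 G : 'M_n,
    G \in unitmx & W^t* *m W = 1%:M /\ B = W *m G.
Proof.
move=> Bfree; have nd : (n <= d)%N by rewrite -(eqP Bfree) rank_leq_col.
have /unitarymxP SS := schmidt_unitarymx B^T nd.
have /submxP[L BL] := schmidt_sub B^T.
exists (schmidt B^T)^T, L^T; last split.
- rewrite unitmx_tr -row_free_unit -row_leq_rank -{1}(eqP Bfree) {1}BL.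
  exact: mxrankM_maxl.
- by rewrite trmxK -[LHS]trmxK trmx_mul trmxK map_trmx SS trmx1.
- by rewrite -trmx_mul -BL trmxK.
Qed.

Let vb Z := vbasis {: subvs_of Z}.

(** The columns of [W] form an orthonormal basis of [Z]; [G] turns coordinates in the basis [vb Z]
    into coordinates in this one. *)
Lemma subspace_isometry Z :
  exists W : 'M[R[i]]_(d, \dim {: subvs_of Z}), exists2 G, G \in unitmx &
    W^t* *m W = 1%:M /\
    forall c, W *m G *m c = vsval (passmx.vecof (vb Z) c^T).
Proof.
pose B : 'M_(d, \dim {: subvs_of Z}) := \matrix_(l, j) vsval (vb Z)`_j l 0.
have BE c : B *m c = vsval (passmx.vecof (vb Z) c^T).
  apply/colP=> l; rewrite mxE /passmx.vecof raddf_sum summxE.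
  apply: eq_bigr => j _; transitivity ((c^T 0 j *: vsval (vb Z)`_j) l 0) => //.
  by rewrite !mxE mulrC.
have Bfree : row_free B^T.
  apply: inj_row_free => v /(congr1 trmx).
  rewrite trmx_mul trmxK BE trmxK trmx0 => /eqP.
  rewrite -[0]/(vsval (0 : subvs_of Z)) (inj_eq subvs_inj).
  by rewrite (passmx.vecof_eq0 (vbasisP _)) => /eqP.
have [W [G Gu [WW BG]]] := gram_schmidt Bfree.
exists W, G; [exact: Gu | split; [exact: WW | by move=> c; rewrite -BG BE]].
Qed.

(** Splitting [x] by [daddv_pi] requires that [Z] meet its complement trivially and that [x] lie in
    their sum; [W^t*] then kills the component in the complement. *)
Lemma orthoproj_inner Z n (W : 'M[R[i]]_(d, n)) x : W^t* *m W = 1%:M ->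
  (forall c, W *m c \in Z) -> {in Z, forall u, W *m (W^t* *m u) = u} ->
  W^t* *m orthoproj Z x = W^t* *m x.
Proof.
move=> WW WZ ZW.
have dir : (Z :&: orthocompl Z = 0)%VS.
  apply/eqP; rewrite -subv0; apply/subvP => v.
  rewrite memv_cap memv0 => /andP[vZ /mem_orthocompl h].
  have v0 : qf 1%:M v = 0 by rewrite /qf mulmx1 h // mxE.
  by apply/negPn/negP => /qf1_gt0; rewrite v0 ltxx.
have full : x \in (Z + orthocompl Z)%VS.
  rewrite -(subrK (W *m (W^t* *m x)) x) addrC memv_add ?WZ //.
  apply/mem_orthocompl => u uZ; rewrite -(ZW u uZ) adjmxM mulmxBr.
  by rewrite -!mulmxA (mulmxA (W^t*) W (W^t* *m x)) WW mul1mx subrr.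
have := daddv_pi_add dir full; rewrite -/(orthoproj Z) => e.
rewrite -[X in _ = _ *m X]e mulmxDr -[LHS]addr0; congr (_ + _); symmetry.
have /mem_orthocompl h := memv_pi (orthocompl Z) Z x.
apply/matrixP => i j; rewrite [RHS]mxE (ord1 j).
have := h _ (WZ (delta_mx i 0)); rewrite adjmxM -mulmxA => /matrixP/(_ 0 0).
rewrite !mxE (bigD1 i) //= big1 ?addr0.
  by rewrite !mxE !eqxx rmorph1 mul1r.
by move=> l li; rewrite !mxE (negbTE li) rmorph0 mul0r.
Qed.

Lemma char_poly_tr n (M : 'M[R[i]]_n) : char_poly M^T = char_poly M.
Proof.
rewrite /char_poly -[RHS]det_tr /char_poly_mx linearB /= tr_scalar_mx.
by rewrite map_trmx.
Qed.

(** In the basis [vb Z] the compression is similar to [W^t* *m A *m W] through [G], up to a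
    transpose due to the row convention of [mxof]. *)
Lemma op_eigenvalues_compression A Z : exists n (W : 'M[R[i]]_(d, n)),
  [/\ W^t* *m W = 1%:M, {in Z, forall u, W *m (W^t* *m u) = u} &
      op_eigenvalues (compression A Z) = eigenvalues (W^t* *m A *m W)].
Proof.
have [W [G Gu [WW WE]]] := subspace_isometry Z.
have WZ c : W *m c \in Z.
  by rewrite -[c](mulKVmx Gu) (mulmxA W) WE subvsP.
have ZW : {in Z, forall u, W *m (W^t* *m u) = u}.
  move=> u uZ; have -> : u = W *m (G *m (passmx.rVof (vb Z) (vsproj Z u))^T).
    by rewrite mulmxA WE trmxK passmx.rVofK ?vbasisP // vsprojK.
  by rewrite (mulmxA (W^t*)) WW mul1mx.
exists _, W; split; [exact: WW | exact: ZW | rewrite /op_eigenvalues -/(vb Z)].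
set M := passmx.mxof _ _ _.
have MG : W^t* *m A *m W *m G = G *m M^T.
  apply: mulmx_cV_inj => c.
  rewrite -!mulmxA (mulmxA W G) WE -(orthoproj_inner _ WW WZ ZW).
  have -> : orthoproj Z (A *m vsval (passmx.vecof (vb Z) c^T)) =
      vsval (compression A Z (passmx.vecof (vb Z) c^T)).
    by rewrite !comp_lfunE !lfunE /= vsprojK ?memv_pi.
  rewrite (passmx.hom_vecof _ (vbasisP _)) -/M -{1}[c]trmxK.
  rewrite -[_ *m M]trmxK -WE trmx_mul trmxK -mulmxA (mulmxA (W^t*)) WW.
  by rewrite mul1mx trmxK.
have -> : eigenvalues M = eigenvalues M^T.
  by apply: eigenvalues_char; rewrite char_poly_tr.
by rewrite -[M^T](mulKmx Gu) -MG eigenvalues_mulmxC mulmxK.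
Qed.

End Compression.

(** * Projections given by orthonormal bases *)

Section OrthonormalBasis.
Variables (R : realType) (d k : nat).
Implicit Types (Z : {vspace 'cV[R[i]]_d}) (X : 'M[R[i]]_(d, k)).

Lemma mulmx_col_fixed m (P : 'M[R[i]]_d) (M : 'M[R[i]]_(d, m)) :
  (forall j, P *m col j M = col j M) -> P *m M = M.
Proof.
move=> h; apply/matrixP=> i j; have /colP/(_ i) := h j.
by rewrite colE mulmxA -!colE !mxE.
Qed.

Lemma orthonormal_basis_mem Z X j : orthonormal_basis Z X -> col j X \in Z.
Proof.
case=> hZ _; apply: (basis_mem hZ).
by apply/mapP; exists j => //; rewrite mem_enum.
Qed.

Lemma orthonormal_basis_proj Z X v : orthonormal_basis Z X -> v \in Z ->
  X *m X^t* *m v = v.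
Proof.
case=> hZ hX vZ; pose P : 'M_d := X *m X^t* - 1%:M.
(* The vectors fixed by [X *m X^t*] form a subspace, so it suffices to check the columns of [X]. *)
suff : v \in lker (linfun (mulmx P : 'cV_d -> 'cV_d)).
  rewrite memv_ker lfunE /= mulmxBl mul1mx subr_eq0 => /eqP; exact.
move: v vZ; apply/subvP; rewrite -(span_basis hZ).
apply/span_subvP => _ /mapP[j _ ->].
rewrite memv_ker lfunE /= mulmxBl mul1mx colE mulmxA -(mulmxA X) hX mulmx1.
by rewrite subrr.
Qed.

End OrthonormalBasis.

Theorem theorem3p13 (R : realType) (d k : nat) (A : 'M[R[i]]_d)
    (XX YY : {vspace 'cV[R[i]]_d}) (X Y : 'M[R[i]]_(d, k))
    (A_selfadjoint : A \is hermsymmx)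
    (dim_XX : \dim XX = k) (dim_YY : \dim YY = k)
    (X_basis : orthonormal_basis XX X) (Y_basis : orthonormal_basis YY Y)
    (XX_invariant : forall v : 'cV[R[i]]_d, v \in XX -> A *m v \in XX)
    (Theta1_lt : (principal_angles X Y)`_0 < pi / 2%:R) :
  let lambdaX := eigenvalues (X^t* *m A *m X) in
  let lambdaY := eigenvalues (Y^t* *m A *m Y) in
  let lambda := op_eigenvalues (compression A (XX + YY)%VS) in
  let lambda_min := last 0 lambda in
  let Theta := principal_angles X Y in
  submajorized
    (\row_(i < k) `|lambdaX`_i - lambdaY`_i|)
    (\row_(i < k)
       (2%:R * (lambda`_i - lambda_min) * sin (Theta`_i) ^+ 2
        / cos (Theta`_i))).

Proof.
move=> lambdaX lambdaY lambda lambda_min Theta; rewrite /lambda_min /lambda.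
have [_ hX] := X_basis; have [_ hY] := Y_basis.
have hA : A^t* = A by apply/eqP; rewrite -hermE.
have [n [W [WW ZW ->]]] := op_eigenvalues_compression A (XX + YY)%VS.
have XW : W *m W^t* *m X = X.
  apply: mulmx_col_fixed => j; rewrite -mulmxA; apply: ZW.
  exact: (subvP (addvSl XX YY)) (orthonormal_basis_mem j X_basis).
have YW : W *m W^t* *m Y = Y.
  apply: mulmx_col_fixed => j; rewrite -mulmxA; apply: ZW.
  exact: (subvP (addvSr XX YY)) (orthonormal_basis_mem j Y_basis).
(* The invariance of [XX] in matrix form. *)
have AX : X *m X^t* *m (A *m X) = A *m X.
  apply: mulmx_col_fixed => j.
  have -> : col j (A *m X) = A *m col j X by rewrite !colE mulmxA.
  apply: (orthonormal_basis_proj X_basis); apply: XX_invariant.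
  exact: (orthonormal_basis_mem j X_basis).
(* [W] is an isometry whose range contains the columns of [X] and [Y], so pulling back by [W^t*]
   keeps their Gram matrices and hence the principal angles. *)
have gramE (U V : 'M_(d, k)) : W *m W^t* *m U = U ->
    (W^t* *m V)^t* *m (W^t* *m U) = V^t* *m U.
  by move=> hU; rewrite (adjmxM (W^t*)) trmxCK -mulmxA (mulmxA W) hU.
have conjE (U : 'M_(d, k)) : W *m W^t* *m U = U ->
    (W^t* *m U)^t* *m (W^t* *m A *m W) *m (W^t* *m U) = U^t* *m A *m U.
  move=> hU; have hU' : U^t* *m (W *m W^t*) = U^t*.
    by rewrite -[RHS]/(U^t*) -{2}hU !adjmxM trmxCK.
  rewrite (adjmxM (W^t*)) trmxCK !mulmxA -(mulmxA (U^t*) W) hU'.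
  by rewrite -(mulmxA _ W (W^t*)) -(mulmxA _ _ U) hU.
have hX' : (W^t* *m X)^t* *m (W^t* *m X) = 1%:M by rewrite gramE.
have hY' : (W^t* *m Y)^t* *m (W^t* *m Y) = 1%:M by rewrite gramE.
have AX' : W^t* *m A *m W *m (W^t* *m X) = W^t* *m X *m
    ((W^t* *m X)^t* *m (W^t* *m A *m W) *m (W^t* *m X)).
  rewrite (conjE _ XW) -(mulmxA _ W) (mulmxA W) XW -(mulmxA _ A) -[in LHS]AX.
  by rewrite !mulmxA.
have kn : (k <= n)%N by apply: mulmx1_min hX'.
apply: (submajorized_subsets (g := fun i => 2%:R *
  ((eigenvalues (W^t* *m A *m W))`_i - last 0 (eigenvalues (W^t* *m A *m W))) *
  sin (Theta`_i) ^+ 2 / cos (Theta`_i))) => D.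
under eq_bigr do rewrite mxE.
have hA' : (W^t* *m A *m W)^t* = W^t* *m A *m W := adj_conj W hA.
have := sum_dist_eigenvalues D hA' hX' hY' AX'.
rewrite (conjE _ XW) (conjE _ YW) (gramE _ _ YW) => /le_trans; apply.
have Dk : (#|D| <= k)%N by rewrite -[k in (_ <= k)%N]card_ord max_card.
apply: ler_sum => i _; have ik := leq_trans (ltn_ord i) Dk.
have [cos0 cos1 ->] := principal_angles_sin_cos hX hY Theta1_lt ik.
rewrite -[leRHS]mulrA -mulrA; apply: ler_wpM2l => //.
have gap : 0 <= (eigenvalues (W^t* *m A *m W))`_i -
    last 0 (eigenvalues (W^t* *m A *m W)).
  rewrite subr_ge0 -nth_last size_eigenvalues le_eigenvalues //.
  have n_gt0 := leq_ltn_trans (leq0n i) (leq_trans ik kn).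
  by rewrite -ltnS prednK // (leq_trans ik kn) leqnn.
apply: ler_wpM2l => //.
(* What remains is that a squared sine is at most itself divided by a cosine in [(0, 1]]. *)
have sin0 := gram_mul_le1 i hX hY.
by rewrite ler_pdivlMr // ler_piMr.
Qed.
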